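(* Let $d\ge 2$, let $\mathcal{H}=\mathbb{C}^d\otimes\mathbb{C}^d$, and let $U$ be a unitary operator on $\mathcal{H}$. Then the disentangling power $\delta(U)$ and the entangling power $\epsilon(U)$ satisfy $$\delta(U)=\frac{d+1}{d(d-1)}\,\epsilon(U).$$
   Context: Fix an orthonormal basis $|1\rangle,\dots,|d\rangle$ of $\mathbb{C}^d$ and write $|ij\rangle=|i\rangle\otimes|j\rangle$. Normalized linear entropy: for a unit vector $|\psi\rangle\in\mathcal{H}=\mathbb{C}^d\otimes\mathbb{C}^d$, $$S_L(|\psi\rangle):=\frac{d}{d-1}\bigl(1-\operatorname{Tr}\rho^2\bigr),\qquad \rho=\operatorname{Tr}_B|\psi\rangle\langle\psi|,$$ where $\operatorname{Tr}_B$ is the partial trace over the second tensor factor. Entangling power: for a unitary $U$ on $\mathcal{H}$, $$\epsilon(U):=\int_{\langle\psi_1|\psi_1\rangle=1}\int_{\langle\psi_2|\psi_2\rangle=1}S_L\bigl(U|\psi_1\rangle|\psi_2\rangle\bigr)\,d\psi_1\,d\psi_2,$$ where $d\psi_1,d\psi_2$ are the normalized uniform (unitarily invariant) probability measures on the unit sphere of $\mathbb{C}^d$ and $|\psi_1\rangle|\psi_2\rangle=|\psi_1\rangle\otimes|\psi_2\rangle$. Disentangling power: for a unitary $U$ on $\mathcal{H}$, $$\delta(U):=1-\int_{U(d)}\int_{U(d)}S_L\bigl(U(V\otimes W)|\psi_+\rangle\bigr)\,dV\,dW,\qquad |\psi_+\rangle=\frac{1}{\sqrt d}\sum_{i=1}^d|ii\rangle,$$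 where $dV,dW$ are the normalized Haar measures on the unitary group $U(d)$. *)

(* Defs.v *)
From mathcomp Require Import all_boot all_order all_algebra.
From mathcomp Require Import all_classical all_reals all_analysis.
From mathcomp Require Import spectral.
From mathcomp Require Export complex mxtens.

Set Implicit Arguments.
Unset Strict Implicit.
Unset Printing Implicit Defensive.

Import Order.TTheory GRing.Theory Num.Theory.
Import numFieldNormedType.Exports.

Local Open Scope classical_set_scope.
Local Open Scope ring_scope.
Local Open Scope sesquilinear_scope.

(* The coefficients are [R[i]^o] because it is [R[i]^o] that carries the norm
   topology, from which matrices inherit theirs. *)
Definition borel_mx (R : realType) (m n : nat) :=
  g_sigma_algebraType (@open 'M[R[i]^o]_(m, n)).

Definition unitary_group (R : realType) (d : nat) : set 'M[R[i]]_d :=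
  [set V | V \is unitarymx].

Definition unit_sphere (R : realType) (d : nat) : set 'cV[R[i]]_d :=
  [set psi | psi^t* *m psi = 1%:M].

(* Haar measure on U(d) and the uniform measure on the sphere are represented
   by their images in the ambient matrix space, that is, by Borel probability
   measures of full mass on U(d), respectively on the sphere. *)
Definition is_haar (R : realType) (d : nat)
    (mu : probability (borel_mx R d d) R) : Prop :=
  mu (@unitary_group R d) = 1%E /\
  forall G : 'M[R[i]]_d, G \is unitarymx ->
  forall A : set (borel_mx R d d), measurable A ->
    mu ((fun V : 'M[R[i]]_d => G *m V) @^-1` A) = mu A.

Definition is_uniform_sphere (R : realType) (d : nat)
    (mu : probability (borel_mx R d 1) R) : Prop :=
  mu (@unit_sphere R d) = 1%E /\
  forall G : 'M[R[i]]_d, G \is unitarymx ->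
  forall A : set (borel_mx R d 1), measurable A ->
    mu ((fun psi : 'cV[R[i]]_d => G *m psi) @^-1` A) = mu A.

Definition ptrace2 (R : realType) (d : nat) (M : 'M[R[i]]_(d * d)) :
    'M[R[i]]_d :=
  \matrix_(i, j) \sum_(k < d) M (mxtens_index (i, k)) (mxtens_index (j, k)).

(* [Re] only changes the type: the trace of the square of a Hermitian matrix
   is real. *)
Definition lin_entropy (R : realType) (d : nat) (psi : 'cV[R[i]]_(d * d)) : R :=
  let rho := ptrace2 (psi *m psi^t*) in
  d%:R / (d%:R - 1) * (1 - complex.Re (\tr (rho *m rho))).

Definition max_entangled (R : realType) (d : nat) : 'cV[R[i]]_(d * d) :=
  (sqrtC d%:R)^-1 *:
    \sum_(i < d) ((delta_mx i 0 : 'cV[R[i]]_d) *t (delta_mx i 0 : 'cV[R[i]]_d)).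

Definition entangling_power (R : realType) (d : nat)
    (mu : probability (borel_mx R d 1) R) (U : 'M[R[i]]_(d * d)) : R :=
  \int[mu]_(psi1 in @unit_sphere R d) \int[mu]_(psi2 in @unit_sphere R d)
    lin_entropy (U *m (psi1 *t psi2)).

Definition disentangling_power (R : realType) (d : nat)
    (nu : probability (borel_mx R d d) R) (U : 'M[R[i]]_(d * d)) : R :=
  1 - \int[nu]_(V in @unitary_group R d) \int[nu]_(W in @unitary_group R d)
    lin_entropy (U *m ((V *t W) *m max_entangled R d)).

(* Main.v *)
Require Import Defs.
From mathcomp Require Import all_boot all_order all_algebra.
From mathcomp Require Import all_classical all_reals all_analysis.
From mathcomp Require Import spectral.
From mathcomp Require Import measurable_realfun fingroup perm ring.

Set Implicit Arguments.
Unset Strict Implicit.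
Unset Printing Implicit Defensive.

Import Order.TTheory GRing.Theory Num.Theory.
Import numFieldNormedType.Exports.
Local Open Scope classical_set_scope.
Local Open Scope ring_scope.
Local Open Scope sesquilinear_scope.

(* The unit sphere and the unitary group are both sets of isometries X with
   X^* X = 1, and their measures are invariant under X |-> G X.  The moments of
   the monomials x_a1 x_a2 conj(x_a3) conj(x_a4) therefore form a tensor
   invariant under G (x) G (x) conj(G) (x) conj(G).  Such a tensor is a
   combination of the two pairings [a1=a3][a2=a4] and [a1=a4][a2=a3], and
   X^* X = 1 prescribes its two contractions, hence its two coefficients.
   The purity of U z is a fixed form of this kind in z.  For z = psi1 (x) psi2
   and for z = (V (x) W) psi_+, whose matrix of coefficients is V W^T / sqrt d,
   its average is thus a combination of the four contractions of the form with
   products of pairings.  Unitarity of U makes two of these equal to d^3, and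
   both powers are affine functions of the sum of the remaining two. *)

(** * Tensors invariant under the unitary group *)

Section Pairings.
Variables (C : numClosedFieldType) (I : finType).

Definition pairing13 (a1 a2 a3 a4 : I) : C := (a1 == a3)%:R * (a2 == a4)%:R.
Definition pairing14 (a1 a2 a3 a4 : I) : C := (a1 == a4)%:R * (a2 == a3)%:R.

(** The last two slots are conjugated, so the pairings that matter join slots 1, 2 to slots 3, 4. *)
Definition monomial22 (z : I -> C) (a1 a2 a3 a4 : I) : C :=
  z a1 * z a2 * (z a3)^* * (z a4)^*.

Lemma sum_prod4 (f1 f2 f3 f4 : I -> C) :
  (\sum_i f1 i) * (\sum_i f2 i) * (\sum_i f3 i) * (\sum_i f4 i) =
  \sum_i1 \sum_i2 \sum_i3 \sum_i4 f1 i1 * f2 i2 * f3 i3 * f4 i4.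
Proof.
rewrite !mulr_suml; apply: eq_bigr => i1 _.
rewrite [f1 i1 * _]mulr_sumr !mulr_suml; apply: eq_bigr => i2 _.
rewrite [f1 i1 * _ * _]mulr_sumr !mulr_suml.
by apply: eq_bigr => i3 _; rewrite mulr_sumr.
Qed.

Lemma sum_delta_l (a : I) (f : I -> C) : \sum_i (a == i)%:R * f i = f a.
Proof.
rewrite (bigD1 a) //= eqxx mul1r big1 ?addr0 // => i.
by rewrite eq_sym => /negbTE ->; rewrite mul0r.
Qed.

End Pairings.

Section InvariantTensors.
Variables (C : numClosedFieldType) (d : nat).
Implicit Types (T : 'I_d -> 'I_d -> 'I_d -> 'I_d -> C) (G : 'M[C]_d).

Definition invariant_tensor T := forall G, G \is unitarymx ->
  forall a1 a2 a3 a4, T a1 a2 a3 a4 =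
    \sum_b1 \sum_b2 \sum_b3 \sum_b4
      G a1 b1 * G a2 b2 * (G a3 b3)^* * (G a4 b4)^* * T b1 b2 b3 b4.

(** Phases will show which entries of an invariant tensor vanish, permutations which ones agree. *)
Definition phase_perm_mx (w : 'I_d -> C) (s : {perm 'I_d}) : 'M[C]_d :=
  \matrix_(i, j) (w i * (s i == j)%:R).

Lemma phase_perm_mx_unitary w s :
  (forall i, w i * (w i)^* = 1) -> phase_perm_mx w s \is unitarymx.
Proof.
move=> hw; apply/unitarymxP/matrixP => i j; rewrite !mxE.
under eq_bigr do rewrite !mxE rmorphM /= conjC_nat mulrACA mulrC -mulrA.
rewrite sum_delta_l (inj_eq perm_inj) eq_sym.
by case: eqP => [->|_]; rewrite ?mul0r ?mul1r ?hw.
Qed.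

(** Row [a] of the matrix has the single nonzero entry [w a], in column [s a], so the fourfold sum
    reduces to one term. *)
Lemma invariant_phase_perm T w (s : {perm 'I_d}) : invariant_tensor T ->
  (forall i, w i * (w i)^* = 1) -> forall a1 a2 a3 a4,
  T a1 a2 a3 a4 = w a1 * w a2 * (w a3)^* * (w a4)^* * T (s a1) (s a2) (s a3) (s a4).
Proof.
move=> invT hw a1 a2 a3 a4.
rewrite (invT _ (phase_perm_mx_unitary s hw)).
pose g b1 b2 b3 b4 := w a1 * w a2 * (w a3)^* * (w a4)^* * T b1 b2 b3 b4.
transitivity (\sum_b1 (s a1 == b1)%:R * \sum_b2 (s a2 == b2)%:R *
   \sum_b3 (s a3 == b3)%:R * \sum_b4 (s a4 == b4)%:R * g b1 b2 b3 b4); last first.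
  by rewrite !sum_delta_l.
apply: eq_bigr => b1 _; rewrite mulr_sumr; apply: eq_bigr => b2 _.
rewrite !mulr_sumr; apply: eq_bigr => b3 _.
rewrite !mulr_sumr; apply: eq_bigr => b4 _.
by rewrite !mxE !rmorphM /= !conjC_nat /g /=; ring.
Qed.

Lemma invariant_perm T (s : {perm 'I_d}) : invariant_tensor T ->
  forall a1 a2 a3 a4, T (s a1) (s a2) (s a3) (s a4) = T a1 a2 a3 a4.
Proof.
move=> invT a1 a2 a3 a4.
by rewrite [RHS](@invariant_phase_perm _ (fun=> 1) s invT) ?conjC1 ?mulr1 ?mul1r // => i; rewrite conjC1 mulr1.
Qed.

(** A diagonal phase matrix multiplies the entry by a product of four phases, which must be 1 if the
    entry is nonzero. When the multisets {a1, a2} and {a3, a4} differ, a phase at one suitable index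
    gives another product. *)
Lemma invariant_support T a1 a2 a3 a4 : invariant_tensor T ->
  ~~ ((a1 == a3) && (a2 == a4)) -> ~~ ((a1 == a4) && (a2 == a3)) ->
  T a1 a2 a3 a4 = 0.
Proof.
move=> invT n13 n14; apply/eqP/negPn/negP => T0.
(* The phase is ['i] and not -1, so that an index occurring twice is still detected. *)
pose w (m i : 'I_d) : C := if i == m then 'i else 1.
have iiC : 'i * ('i : C)^* = 1 by rewrite conjCi mulrN -expr2 sqrCi opprK.
have wwC m i : w m i * (w m i)^* = 1.
  by rewrite /w; case: eqP => _; rewrite ?iiC // conjC1 mulr1.
have w1 m : w m a1 * w m a2 * (w m a3)^* * (w m a4)^* = 1.
  apply: (mulIf T0); rewrite mul1r [RHS](invariant_phase_perm 1 invT (wwC m)).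
  by rewrite !perm1.
have i1 : 'i != 1 :> C.
  apply/eqP => /(congr1 (fun x => x ^+ 2)); rewrite sqrCi expr1n => /eqP.
  by rewrite eqNr oner_eq0.
have ii1 : 'i * 'i != 1 :> C by rewrite -expr2 sqrCi eqNr oner_eq0.
(* The phases of [a1] and [a3] cancel, and a phase at [a2] leaves ['i], since [a4] differs from
   [a2]. *)
have [e13|ne13] := eqVneq a1 a3.
  have := w1 a2; rewrite -e13 [w a2 a1 * _]mulrC -(mulrA (w a2 a2)) wwC mulr1.
  rewrite /w eqxx; move: n13; rewrite e13 eqxx /= eq_sym => /negbTE ->.
  by rewrite conjC1 mulr1; apply/eqP.
have [e14|ne14] := eqVneq a1 a4.
  have := w1 a2; rewrite -e14 mulrAC [w a2 a1 * _]mulrC -(mulrA (w a2 a2)) wwC mulr1.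
  rewrite /w eqxx; move: n14; rewrite e14 eqxx /= eq_sym => /negbTE ->.
  by rewrite conjC1 mulr1; apply/eqP.
(* Now [a1] differs from [a3] and [a4]: a phase at [a1] leaves ['i], or its square -1 if
   [a2 = a1]. *)
have := w1 a1; rewrite /w eqxx (eq_sym a3) (eq_sym a4) (negbTE ne13) (negbTE ne14).
rewrite conjC1 !mulr1; case: eqP => _; rewrite ?mulr1; exact/eqP.
Qed.

(* The reflection along [e_i + 2 e_j]: it mixes two coordinates with rational
   coefficients. *)
Definition mixing_reflection (i j : 'I_d) : 'M[C]_d :=
  let v : 'cV[C]_d := delta_mx i 0 + 2 *: delta_mx j 0 in
  1%:M - (2 / 5) *: (v *m v^T).

(** A Householder reflection: [v] is real with [v^T v = 5], so the matrix is Hermitian and, as 2/5 +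
    2/5 = 5 (2/5)^2, an involution. *)
Lemma mixing_reflection_unitary i j : i != j ->
  mixing_reflection i j \is unitarymx.
Proof.
move=> nij; rewrite /mixing_reflection.
set v : 'cV[C]_d := _ + _; set G := _ - _.
have vv : v^T *m v = 5%:M.
  rewrite /v [(_ + _)^T]linearD /= [(_ *: _)^T]linearZ /= !trmx_delta mulmxDl !mulmxDr.
  rewrite -!scalemxAl -!scalemxAr !mul_delta_mx_cond eqxx (negbTE nij).
  rewrite eq_sym (negbTE nij) !mulr0n !mulr1n !scaler0 addr0 add0r scalerA.
  apply/matrixP => x y; rewrite !mxE !ord1 !eqxx /=.
  by rewrite mulr1n mxE !eqxx /=; ring.
have vC x : (v x 0)^* = v x 0 by rewrite !mxE rmorphD rmorphM /= !conjC_nat.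
have kC : (2 / 5 : C)^* = 2 / 5 by rewrite rmorphM /= fmorphV /= !conjC_nat.
have GE x y : G x y = (x == y)%:R - 2 / 5 * (v x 0 * v y 0).
  by rewrite [LHS]mxE [X in X + _]mxE [X in _ + X]mxE [X in - X]mxE mxE big_ord1 [v^T _ _]mxE.
have GC : G^t* = G.
  apply/matrixP => x y; rewrite [LHS]mxE [X in X^*]mxE !GE.
  rewrite rmorphB /= rmorphM /= [X in _ - _ * X]rmorphM /= !vC kC conjC_nat eq_sym.
  by rewrite [v y 0 * _]mulrC.
apply/unitarymxP; rewrite GC /G mulmxBl mul1mx mulmxBr mulmx1.
rewrite -scalemxAl -scalemxAr mulmxA -(mulmxA v) vv.
rewrite mul_mx_scalar -scalemxAl !scalerA opprB.
rewrite -addrA -[RHS]addr0; congr (_ + _).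
rewrite -[- (_ *: (v *m _))]scaleNr -2!scalerDl -[RHS](scale0r (v *m v^T)).
by congr (_ *: _); field.
Qed.

(** Invariance under the reflection expands [T i i i i] over the indices [i] and [j]; the support
    lemma and the exchange of [i] and [j] turn the sixteen terms into one linear equation. *)
Lemma invariant_diag T i j : invariant_tensor T -> i != j ->
  T i i i i = T i j i j + T i j j i.
Proof.
move=> invT nij.
(* Row [i] of the reflection: 1 - 2/5 = 3/5 at [i] and -4/5 at [j]. *)
pose g b : C := (i == b)%:R * (3 / 5) - (j == b)%:R * (4 / 5).
have sum_g f : \sum_b g b * f b = 3 / 5 * f i - 4 / 5 * f j.
  under eq_bigr do rewrite mulrBl -!mulrA.
  by rewrite sumrB !sum_delta_l !mulrA.
have GE b : mixing_reflection i j i b = g b.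
  rewrite /mixing_reflection !mxE big_ord1 !mxE !eqxx (negbTE nij) /= /g.
  rewrite !andbT (eq_sym b i) (eq_sym b j).
  by have [<-|_] := eqVneq i b; case: (j == _); field.
have gC b : (g b)^* = g b.
  have nC (m n : nat) : (m%:R / n%:R : C)^* = m%:R / n%:R.
    by rewrite rmorphM /= fmorphV /= !conjC_nat.
  by rewrite /g rmorphB /= [X in X - _]rmorphM [X in _ - X]rmorphM /= !conjC_nat !nC.
have expand : T i i i i = \sum_b1 g b1 * \sum_b2 g b2 *
    \sum_b3 g b3 * \sum_b4 g b4 * T b1 b2 b3 b4.
  rewrite (invT _ (mixing_reflection_unitary nij)).
  apply: eq_bigr => b1 _; rewrite mulr_sumr; apply: eq_bigr => b2 _.
  rewrite !mulr_sumr; apply: eq_bigr => b3 _.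
  rewrite !mulr_sumr; apply: eq_bigr => b4 _.
  by rewrite !GE !gC !mulrA.
have swap a1 a2 a3 a4 : T (tperm i j a1) (tperm i j a2) (tperm i j a3) (tperm i j a4)
    = T a1 a2 a3 a4 by exact: invariant_perm.
have ejj : T j j j j = T i i i i by rewrite -swap tpermR.
have eji : T j i j i = T i j i j by rewrite -swap tpermR tpermL.
have ejj' : T j i i j = T i j j i by rewrite -swap tpermR tpermL.
have nji : j != i by rewrite eq_sym.
have z a1 a2 a3 a4 := @invariant_support T a1 a2 a3 a4 invT.
move: expand; rewrite !sum_g ejj eji ejj'.
rewrite (z i i i j) ?(z i i j i) ?(z i i j j) ?(z i j i i) ?(z i j j j) ?eqxx ?(negbTE nij) ?(negbTE nji) //.
rewrite (z j i i i) ?(z j i j j) ?(z j j i i) ?(z j j i j) ?(z j j j i) ?eqxx ?(negbTE nij) ?(negbTE nji) //.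
move: (T i i i i) (T i j i j) (T i j j i) => p x y e.
(* Six terms survive: the diagonal ones with weights 81/625 and 256/625, and four mixed ones with
   weight 144/625 each. Hence [p = 337/625 p + 288/625 (x + y)], and 1 - 337/625 = 288/625. *)
have h0 : (288 / 625 : C) != 0 by rewrite mulf_neq0 ?invr_neq0 ?pnatr_eq0.
apply: (mulfI h0); apply/eqP; rewrite -subr_eq0; apply/eqP.
transitivity (p - p); last by rewrite subrr.
by rewrite {3}e; field.
Qed.

(** Two-transitivity: after [a] is moved to [i], a transposition fixing [i] moves the image of [b]
    to [j]. *)
Lemma perm_move2 (a b i j : 'I_d) : a != b -> i != j ->
  exists s : {perm 'I_d}, s a = i /\ s b = j.
Proof.
move=> nab nij; exists (tperm a i * tperm (tperm a i b) j)%g; rewrite !permM tpermL.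
split; last by rewrite tpermL.
apply: tpermD; last by rewrite eq_sym.
by rewrite -{2}(tpermL a i) (inj_eq perm_inj) eq_sym.
Qed.

(** Off the diagonal, two-transitivity makes all entries of one pattern equal, which gives [x] and
    [y]; on the diagonal both pairings are 1 and the entry is [x + y]. *)
Lemma invariant_tensor_span T : (2 <= d)%N -> invariant_tensor T ->
  exists x y, forall a1 a2 a3 a4,
    T a1 a2 a3 a4 = x * pairing13 C a1 a2 a3 a4 + y * pairing14 C a1 a2 a3 a4.
Proof.
move=> d2 invT; have d0 : (0 < d)%N by apply: leq_trans d2.
pose i := Ordinal d0; pose j := Ordinal d2; have nij : i != j by [].
exists (T i j i j), (T i j j i) => a1 a2 a3 a4; rewrite /pairing13 /pairing14.
have diag a : T a a a a = T i j i j + T i j j i.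
  rewrite -(invariant_diag invT nij) -(invariant_perm (tperm a i) invT).
  by rewrite tpermL.
have [/andP[/eqP <- /eqP <-]|n13] := boolP ((a1 == a3) && (a2 == a4)).
  have [<-|n12] := eqVneq a1 a2; first by rewrite eqxx !mulr1 diag.
  have [s [<- <-]] := perm_move2 n12 nij.
  by rewrite !invariant_perm // !eqxx mul0r mulr0 addr0 !mulr1.
have [/andP[/eqP <- /eqP <-]|n14] := boolP ((a1 == a4) && (a2 == a3)).
  have [e12|n12] := eqVneq a1 a2; first by rewrite e12 !eqxx !mulr1 diag.
  have [s [<- <-]] := perm_move2 n12 nij.
  by rewrite !invariant_perm // !eqxx mul0r mulr0 add0r !mulr1.
rewrite invariant_support // -!natrM !mulnb.
by rewrite (negbTE n13) (negbTE n14) !mulr0 addr0.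
Qed.

(** The Gram matrix of the two pairings. *)
Lemma sum_pairings :
  [/\ \sum_a \sum_b pairing13 C (a : 'I_d) b a b = d%:R ^+ 2,
      \sum_a \sum_b pairing14 C (a : 'I_d) b a b = d%:R,
      \sum_a \sum_b pairing13 C (a : 'I_d) b b a = d%:R &
      \sum_a \sum_b pairing14 C (a : 'I_d) b b a = d%:R ^+ 2].
Proof.
have s1 : \sum_(a < d) \sum_(b < d) 1 = d%:R ^+ 2 :> C.
  under eq_bigr do rewrite sumr_const card_ord.
  by rewrite sumr_const card_ord -[LHS]mulr_natr expr2.
have s2 : \sum_(a < d) \sum_(b < d) (a == b)%:R * (b == a)%:R = d%:R :> C.
  under eq_bigr do rewrite sum_delta_l eqxx.
  by rewrite sumr_const card_ord.
rewrite /pairing13 /pairing14; split => //; rewrite -[RHS]s1;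
  by apply: eq_bigr => a _; apply: eq_bigr => b _; rewrite !eqxx mulr1.
Qed.

(** The contractions give the system [c13 = x d^2 + y d], [c14 = x d + y d^2], invertible for
    [d >= 2]. Its inverse holds the Weingarten coefficients of degree two. *)
Lemma invariant_tensor_contractions T c13 c14 : (2 <= d)%N -> invariant_tensor T ->
  \sum_a \sum_b T a b a b = c13 -> \sum_a \sum_b T a b b a = c14 ->
  forall a1 a2 a3 a4, T a1 a2 a3 a4 =
    (d%:R * (d%:R ^+ 2 - 1))^-1 *
    (pairing13 C a1 a2 a3 a4 * (d%:R * c13 - c14) +
     pairing14 C a1 a2 a3 a4 * (d%:R * c14 - c13)).
Proof.
move=> d2 invT; have [x [y TE]] := invariant_tensor_span d2 invT.
have [s1 s2 s3 s4] := sum_pairings.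
have lin (f g : 'I_d -> 'I_d -> C) : \sum_a \sum_b (x * f a b + y * g a b) =
    x * (\sum_a \sum_b f a b) + y * (\sum_a \sum_b g a b).
  rewrite !mulr_sumr -big_split; apply: eq_bigr => a _ /=.
  by rewrite !mulr_sumr -big_split.
have -> : \sum_a \sum_b T a b a b = x * d%:R ^+ 2 + y * d%:R.
  by under eq_bigr do under eq_bigr do rewrite TE; rewrite lin s1 s2.
have -> : \sum_a \sum_b T a b b a = x * d%:R + y * d%:R ^+ 2.
  by under eq_bigr do under eq_bigr do rewrite TE; rewrite lin s3 s4.
move=> <- <- a1 a2 a3 a4; rewrite TE.
have dN0 : d%:R != 0 :> C by rewrite pnatr_eq0 -lt0n; apply: leq_trans d2.
have d1N0 : d%:R ^+ 2 - 1 != 0 :> C.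
  rewrite subr_eq0 sqrp_eq1 ?ler0n // pnatr_eq1.
  by apply: contraTneq d2 => ->.
by field; rewrite dN0 d1N0.
Qed.

End InvariantTensors.

(** * Monomials in the entries of an isometry *)

Section MatrixMonomials.
Variables (C : numClosedFieldType) (d m : nat).
Implicit Types (Y : 'M[C]_(d, m)) (k : 'I_m) (a : 'I_d).

(** The row indices [a] transform under left multiplication; the column indices [k] are
    parameters. *)
Definition mx_monomial22 k1 k2 k3 k4 a1 a2 a3 a4 Y : C :=
  Y a1 k1 * Y a2 k2 * (Y a3 k3)^* * (Y a4 k4)^*.

Lemma mx_monomial22_mulmx k1 k2 k3 k4 a1 a2 a3 a4 (G : 'M[C]_d) Y :
  mx_monomial22 k1 k2 k3 k4 a1 a2 a3 a4 (G *m Y) =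
  \sum_b1 \sum_b2 \sum_b3 \sum_b4
    G a1 b1 * G a2 b2 * (G a3 b3)^* * (G a4 b4)^* *
    mx_monomial22 k1 k2 k3 k4 b1 b2 b3 b4 Y.
Proof.
rewrite /mx_monomial22 !mxE !rmorph_sum sum_prod4.
do 4 apply: eq_bigr => ? _; rewrite !rmorphM /=; ring.
Qed.

Lemma isometryE Y : Y^t* *m Y = 1%:M ->
  forall k l, \sum_a Y a k * (Y a l)^* = (k == l)%:R.
Proof.
move=> YY k l; have /matrixP/(_ l k) := YY; rewrite !mxE eq_sym => <-.
by apply: eq_bigr => a _; rewrite !mxE mulrC.
Qed.

(** The two row sums factor into inner products of orthonormal columns. *)
Lemma contract13 k1 k2 k3 k4 Y : Y^t* *m Y = 1%:M ->
  \sum_a \sum_b mx_monomial22 k1 k2 k3 k4 a b a b Y = pairing13 C k1 k2 k3 k4.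
Proof.
move=> YY; rewrite /pairing13 -!(isometryE YY) mulr_suml; apply: eq_bigr => a _.
rewrite mulr_sumr; apply: eq_bigr => b _; rewrite /mx_monomial22; ring.
Qed.

Lemma contract14 k1 k2 k3 k4 Y : Y^t* *m Y = 1%:M ->
  \sum_a \sum_b mx_monomial22 k1 k2 k3 k4 a b b a Y = pairing14 C k1 k2 k3 k4.
Proof.
move=> YY; rewrite /pairing14 -!(isometryE YY) mulr_suml; apply: eq_bigr => a _.
rewrite mulr_sumr; apply: eq_bigr => b _; rewrite /mx_monomial22; ring.
Qed.

Lemma isometry_entry_le1 Y a k : Y^t* *m Y = 1%:M -> `|Y a k| <= 1.
Proof.
move=> YY; have := isometryE YY k k; rewrite eqxx /= => e.
rewrite -(@expr_le1 _ 2) // normCK -[X in _ <= X]e (bigD1 a) //= lerDl.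
by apply: sumr_ge0 => b _; rewrite mul_conjC_ge0.
Qed.

(** This bound makes the monomials integrable over the isometries. *)
Lemma isometry_monomial_le1 k1 k2 k3 k4 a1 a2 a3 a4 Y : Y^t* *m Y = 1%:M ->
  `|mx_monomial22 k1 k2 k3 k4 a1 a2 a3 a4 Y| <= 1.
Proof.
move=> YY; rewrite /mx_monomial22 !normrM !norm_conjC.
by rewrite !mulr_ile1 ?mulr_ge0 ?isometry_entry_le1.
Qed.

End MatrixMonomials.

(** * Purity as a quartic form *)

Section Purity.
Variables (R : realType) (d : nat).
Implicit Types (U : 'M[R[i]]_(d * d)) (z : 'cV[R[i]]_(d * d)).
Local Notation C := R[i].

(** Kept complex, so as to be a polynomial in the entries of [z] and their conjugates. *)
Definition purity z : C :=
  let rho := ptrace2 (z *m z^t*) in \tr (rho *m rho).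

(** Matrix entries, from (p1, p2) to (p3, p4), of the exchange of the first tensor factors of two
    copies of the space, conjugated by U (x) U. *)
Definition purity_coef U (p1 p2 p3 p4 : 'I_(d * d)) : C :=
  \sum_i \sum_j \sum_k \sum_l
    U (mxtens_index (i, k)) p1 * U (mxtens_index (j, l)) p2 *
    (U (mxtens_index (j, k)) p3)^* * (U (mxtens_index (i, l)) p4)^*.

Lemma sum4_mulr_suml (I J : finType) (F : J -> I -> I -> I -> I -> C)
    (g : I -> I -> I -> I -> C) :
  \sum_j \sum_i1 \sum_i2 \sum_i3 \sum_i4 F j i1 i2 i3 i4 * g i1 i2 i3 i4 =
  \sum_i1 \sum_i2 \sum_i3 \sum_i4 (\sum_j F j i1 i2 i3 i4) * g i1 i2 i3 i4.
Proof.
rewrite exchange_big; apply: eq_bigr => i1 _.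
rewrite exchange_big; apply: eq_bigr => i2 _.
rewrite exchange_big; apply: eq_bigr => i3 _.
rewrite exchange_big; apply: eq_bigr => i4 _.
by rewrite mulr_suml.
Qed.

Lemma purity_mulmx U z : purity (U *m z) =
  \sum_p1 \sum_p2 \sum_p3 \sum_p4
    purity_coef U p1 p2 p3 p4 * monomial22 (z^~ 0) p1 p2 p3 p4.
Proof.
have psiE i k j l : ((U *m z) *m (U *m z)^t*) (mxtens_index (i, k)) (mxtens_index (j, l)) =
   (U *m z) (mxtens_index (i, k)) 0 * ((U *m z) (mxtens_index (j, l)) 0)^*.
  by rewrite [LHS]mxE big_ord1 [X in _ * X = _]mxE [_^T _ _]mxE.
transitivity (\sum_i \sum_j \sum_k \sum_l
  (U *m z) (mxtens_index (i, k)) 0 * (U *m z) (mxtens_index (j, l)) 0 *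
  ((U *m z) (mxtens_index (j, k)) 0)^* * ((U *m z) (mxtens_index (i, l)) 0)^*).
  rewrite /purity /mxtrace; apply: eq_bigr => i _; rewrite mxE.
  apply: eq_bigr => j _; rewrite !mxE mulr_suml; apply: eq_bigr => k _.
  rewrite mulr_sumr; apply: eq_bigr => l _; rewrite !psiE; ring.
under eq_bigr do under eq_bigr do under eq_bigr do under eq_bigr do
  rewrite !mxE !rmorph_sum sum_prod4.
rewrite /purity_coef.
(* The sums over [i], [j], [k], [l] hidden in the coefficient come out one at a time. *)
do 4 (rewrite -sum4_mulr_suml; apply: eq_bigr => ? _).
do 4 apply: eq_bigr => ? _; rewrite /monomial22 !rmorphM /=; ring.
Qed.

Lemma sum4E (I : finType) (F : I -> I -> I -> I -> C) :
  \sum_i1 \sum_i2 \sum_i3 \sum_i4 F i1 i2 i3 i4 =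
  \sum_(q : I * I * I * I) F q.1.1.1 q.1.1.2 q.1.2 q.2.
Proof. by rewrite !pair_bigA. Qed.

(** In each tensor factor, [D13] stands for the trace against the identity and [D14] for the trace
    against the exchange of the two copies. *)
Definition contract_coef U (f g : 'I_d -> 'I_d -> 'I_d -> 'I_d -> C) : C :=
  let u1 p := (mxtens_unindex p).1 in let u2 p := (mxtens_unindex p).2 in
  \sum_p1 \sum_p2 \sum_p3 \sum_p4 purity_coef U p1 p2 p3 p4 *
    (f (u1 p1) (u1 p2) (u1 p3) (u1 p4) * g (u2 p1) (u2 p2) (u2 p3) (u2 p4)).

Local Notation D13 := (@pairing13 C 'I_d).
Local Notation D14 := (@pairing14 C 'I_d).

Lemma mxtens_unindex_eq (p q : 'I_(d * d)) :
  (p == q) = ((mxtens_unindex p).1 == (mxtens_unindex q).1) &&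
             ((mxtens_unindex p).2 == (mxtens_unindex q).2).
Proof. by rewrite -(can_eq (@mxtens_unindexK d d)). Qed.

Lemma sum_out (I J : finType) (F : I -> I -> J -> C) :
  \sum_x \sum_y \sum_j F x y j = \sum_j \sum_x \sum_y F x y j.
Proof. by rewrite [RHS]exchange_big; apply: eq_bigr => x _; rewrite [RHS]exchange_big. Qed.

Lemma unitary_rowsE U : U \is unitarymx ->
  forall p q, \sum_r U p r * (U q r)^* = (p == q)%:R.
Proof.
move=> /unitarymxP/matrixP UU p q; have := UU p q; rewrite !mxE => <-.
by apply: eq_bigr => r _; rewrite !mxE.
Qed.

Lemma sum_const_ord (x : C) : \sum_(i < d) x = d%:R * x.
Proof. by rewrite sumr_const card_ord mulr_natl. Qed.

Lemma eq_mxtens_index (p q : 'I_d * 'I_d) :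
  (mxtens_index p == mxtens_index q) = (p == q).
Proof. by rewrite (can_eq (@mxtens_indexK d d)). Qed.

(** A full trace: [U] drops out, and the exchange of the first factors has trace d on them and d^2
    on the second factors. *)
Lemma contract_coef1313 U : U \is unitarymx -> contract_coef U D13 D13 = d%:R ^+ 3.
Proof.
move=> hU; transitivity (\sum_p1 \sum_p2 purity_coef U p1 p2 p1 p2).
  apply: eq_bigr => p1 _; apply: eq_bigr => p2 _.
  transitivity (\sum_p3 (p1 == p3)%:R *
    \sum_p4 (p2 == p4)%:R * purity_coef U p1 p2 p3 p4); last by rewrite !sum_delta_l.
  apply: eq_bigr => p3 _; rewrite mulr_sumr; apply: eq_bigr => p4 _.
  by rewrite !mxtens_unindex_eq -!mulnb !natrM /pairing13; ring.
(* Orthonormality of the rows of [U] will leave exactly these terms. *)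
have -> : d%:R ^+ 3 = \sum_(i < d) \sum_(j < d) \sum_(k < d) \sum_(l < d)
    (i == j)%:R * (j == i)%:R :> C.
  under eq_bigr do under eq_bigr do rewrite !sum_const_ord.
  by under eq_bigr do rewrite -!mulr_sumr sum_delta_l eqxx mulr1; rewrite sum_const_ord; ring.
rewrite /purity_coef; rewrite sum_out; apply: eq_bigr => i _.
rewrite sum_out; apply: eq_bigr => j _; rewrite sum_out; apply: eq_bigr => k _.
rewrite sum_out; apply: eq_bigr => l _.
transitivity ((\sum_p U (mxtens_index (i, k)) p * (U (mxtens_index (j, k)) p)^*) *
   \sum_p U (mxtens_index (j, l)) p * (U (mxtens_index (i, l)) p)^*).
  rewrite mulr_suml; apply: eq_bigr => p _; rewrite mulr_sumr.
  by apply: eq_bigr => q _; ring.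
by rewrite !unitary_rowsE // !eq_mxtens_index !xpair_eqE !eqxx !andbT.
Qed.

(** The full exchange of the two copies commutes with U (x) U; composed with the exchange of the
    first factors it exchanges the second ones, again of trace d^3. *)
Lemma contract_coef1414 U : U \is unitarymx -> contract_coef U D14 D14 = d%:R ^+ 3.
Proof.
move=> hU; transitivity (\sum_p1 \sum_p2 purity_coef U p1 p2 p2 p1).
  apply: eq_bigr => p1 _; apply: eq_bigr => p2 _.
  transitivity (\sum_p3 (p2 == p3)%:R *
    \sum_p4 (p1 == p4)%:R * purity_coef U p1 p2 p3 p4); last by rewrite !sum_delta_l.
  apply: eq_bigr => p3 _; rewrite mulr_sumr; apply: eq_bigr => p4 _.
  by rewrite !mxtens_unindex_eq -!mulnb !natrM /pairing14; ring.
have -> : d%:R ^+ 3 = \sum_(i < d) \sum_(j < d) \sum_(k < d) \sum_(l < d)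
    (k == l)%:R * (l == k)%:R :> C.
  rewrite !sum_const_ord.
  by under eq_bigr do rewrite sum_delta_l eqxx; rewrite sum_const_ord mulr1; ring.
rewrite /purity_coef; rewrite sum_out; apply: eq_bigr => i _.
rewrite sum_out; apply: eq_bigr => j _; rewrite sum_out; apply: eq_bigr => k _.
rewrite sum_out; apply: eq_bigr => l _.
transitivity ((\sum_p U (mxtens_index (i, k)) p * (U (mxtens_index (i, l)) p)^*) *
   \sum_p U (mxtens_index (j, l)) p * (U (mxtens_index (j, k)) p)^*).
  rewrite mulr_suml; apply: eq_bigr => p _; rewrite mulr_sumr.
  by apply: eq_bigr => q _; ring.
by rewrite !unitary_rowsE // !eq_mxtens_index !xpair_eqE !eqxx.
Qed.

Lemma contract_coef_bilinear U (x1 x2 x3 x4 : C) :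
  \sum_p1 \sum_p2 \sum_p3 \sum_p4 purity_coef U p1 p2 p3 p4 *
    ((let f D D' := D (mxtens_unindex p1).1 (mxtens_unindex p2).1
             (mxtens_unindex p3).1 (mxtens_unindex p4).1 *
           D' (mxtens_unindex p1).2 (mxtens_unindex p2).2
             (mxtens_unindex p3).2 (mxtens_unindex p4).2 in
     x1 * f D13 D13 + x2 * f D13 D14 + x3 * f D14 D13 + x4 * f D14 D14)) =
  x1 * contract_coef U D13 D13 + x2 * contract_coef U D13 D14 +
  x3 * contract_coef U D14 D13 + x4 * contract_coef U D14 D14.
Proof.
rewrite /contract_coef !sum4E !mulr_sumr -!big_split; apply: eq_bigr => q _ /=.
ring.
Qed.

End Purity.

(** * Complex-valued integrals on matrix spaces *)

Section Borel.
Variable R : realType.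
Local Notation C := R[i].

Lemma continuous_borel_mx_measurable m n (f : 'M[C^o]_(m, n) -> R) :
  continuous f -> measurable_fun setT (f : borel_mx R m n -> R).
Proof.
move=> /continuousP cf; apply: (measurability _ (RGenOpens.measurableE R)).
move=> _ [_ [a [b ->] <-]]; rewrite setTI.
apply: sub_sigma_algebra; exact/cf/interval_open.
Qed.

Lemma Re_continuous : continuous (@complex.Re R : C^o -> R).
Proof.
move=> z A /nbhs_ballP[e /= e0 sA]; apply/nbhs_ballP; exists (e%:C%C) => /=.
  by rewrite ltcR.
move=> w /= zw; apply: sA; move: zw; rewrite /ball /= /ball_ => zw.
rewrite -ltcR; apply: le_lt_trans zw.
by rewrite -raddfB; apply: normc_ge_Re.
Qed.

Lemma Im_continuous : continuous (@complex.Im R : C^o -> R).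
Proof.
move=> z A /nbhs_ballP[e /= e0 sA]; apply/nbhs_ballP; exists (e%:C%C) => /=.
  by rewrite ltcR.
move=> w /= zw; apply: sA; move: zw; rewrite /ball /= /ball_ => zw.
rewrite -ltcR; apply: le_lt_trans zw.
rewrite -raddfB -normrN -[X in _ <= X]normr_id.
(* Multiplication by ['i] preserves the modulus, so the bound for real parts serves imaginary parts
   too. *)
have -> (x : C) : - complex.Im x = complex.Re ('i * x) by case: x => a b; rewrite /= mul0r mul1r sub0r.
by rewrite normr_id (le_trans (normc_ge_Re _)) // normrM normCi mul1r.
Qed.

Lemma mulmx_continuous d n (G : 'M[C]_d) :
  continuous ((fun M => G *m M) : 'M[C^o]_(d, n) -> 'M[C^o]_(d, n)).
Proof.
move=> M A [P MP sPA].
have e i j : (fun X : 'M[C^o]_(d, n) => (G *m X) i j : C^o) @ nbhs M --> ((G *m M) i j : C^o).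
  have mE (X : 'M[C^o]_(d, n)) : (G *m X) i j = \sum_k (G i k : C^o) * X k j by rewrite mxE.
  rewrite mE (funext mE).
  have c k : (fun X : 'M[C^o]_(d, n) => (G i k : C^o) * X k j) @ nbhs M --> (G i k : C^o) * M k j.
    by apply: cvgMl_tmp; exact: coord_continuous.
  exact: (@cvg_big C^o _ _ _ xpredT (@add_continuous C^o) _ (nbhs M)
     (index_enum _) _ _ _ (fun k _ => c k)).
have FM : Filter (nbhs M) by exact: nbhs_filter.
(* The entries are finite in number, so their conditions hold together on a neighbourhood. *)
have : nbhs M [set X | forall i j, P i j ((G *m X) i j)].
  apply: (@filter_forall _ _ (fun i => [set X | forall j, P i j ((G *m X) i j)]) _ FM) => i.
  apply: (@filter_forall _ _ (fun j => [set X | P i j ((G *m X) i j)]) _ FM) => j.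
  exact: (e i j _ (MP i j)).
apply: filterS => X hX; exact: sPA.
Qed.

Lemma mulmx_measurable d n (G : 'M[C]_d) :
  measurable_fun setT ((fun M => G *m M) : borel_mx R d n -> borel_mx R d n).
Proof.
apply: (@measurability _ _ (borel_mx R d n) (borel_mx R d n) _ _ (@open 'M[C^o]_(d, n)) erefl).
move=> _ [A oA <-]; rewrite setTI.
apply: sub_sigma_algebra.
have /continuousP := @mulmx_continuous d n G.
exact.
Qed.
End Borel.

(** * Integration by real and imaginary parts *)

Section ComplexIntegral.
Variables (R : realType) (disp : measure_display) (T : measurableType disp).
Variables (mu : probability T R) (D : set T) (mD : measurable D).
Local Notation C := R[i].
Implicit Types f g : T -> C.

(** Measurability is asked on the whole space, for composition with X |-> G X; integrability only
    over [D], where bounds are available. *)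
Definition cmeasurable f :=
  measurable_fun setT (@complex.Re R \o f) /\ measurable_fun setT (@complex.Im R \o f).

Definition cintegrable f :=
  mu.-integrable D (EFin \o (@complex.Re R \o f)) /\
  mu.-integrable D (EFin \o (@complex.Im R \o f)).

Definition cintegral f : C :=
  ((\int[mu]_(x in D) complex.Re (f x)) +i* (\int[mu]_(x in D) complex.Im (f x)))%C.

Lemma ReM (z w : C) : complex.Re (z * w) =
  complex.Re z * complex.Re w - complex.Im z * complex.Im w.
Proof. by case: z w => [a b] [c d]. Qed.

Lemma ImM (z w : C) : complex.Im (z * w) =
  complex.Re z * complex.Im w + complex.Im z * complex.Re w.
Proof. by case: z w => [a b] [c d]. Qed.

Lemma ReJ (z : C) : complex.Re (z^*) = complex.Re z.
Proof. by case: z. Qed.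

Lemma ImJ (z : C) : complex.Im (z^*) = - complex.Im z.
Proof. by case: z. Qed.

Lemma cmeasurable_cst (c : C) : cmeasurable (fun=> c).
Proof. by split; exact: measurable_cst. Qed.

Lemma cmeasurableM f g : cmeasurable f -> cmeasurable g -> cmeasurable (fun x => f x * g x).
Proof.
move=> [f1 f2] [g1 g2]; split.
  rewrite (_ : _ \o _ = ((@complex.Re R \o f) \* (@complex.Re R \o g)) \-
    ((@complex.Im R \o f) \* (@complex.Im R \o g))); last by apply/funext => x /=; rewrite ReM.
  by apply: measurable_funB; apply: measurable_funM.
rewrite (_ : _ \o _ = ((@complex.Re R \o f) \* (@complex.Im R \o g)) \+
  ((@complex.Im R \o f) \* (@complex.Re R \o g))); last by apply/funext => x /=; rewrite ImM.
by apply: measurable_funD; apply: measurable_funM.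
Qed.

Lemma cmeasurableD f g : cmeasurable f -> cmeasurable g -> cmeasurable (fun x => f x + g x).
Proof.
move=> [f1 f2] [g1 g2]; split.
  rewrite (_ : _ \o _ = (@complex.Re R \o f) \+ (@complex.Re R \o g)); last first.
    by apply/funext => x /=; rewrite raddfD.
  exact: measurable_funD.
rewrite (_ : _ \o _ = (@complex.Im R \o f) \+ (@complex.Im R \o g)); last first.
  by apply/funext => x /=; rewrite raddfD.
exact: measurable_funD.
Qed.

Lemma cmeasurable_sum (I : Type) (r : seq I) (f : I -> T -> C) :
  (forall i, cmeasurable (f i)) -> cmeasurable (fun x => \sum_(i <- r) f i x).
Proof.
move=> mf; elim: r => [|i r IH].
  by under eq_fun do rewrite big_nil; exact: cmeasurable_cst.
by under eq_fun do rewrite big_cons; exact: cmeasurableD.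
Qed.

Lemma cmeasurableJ f : cmeasurable f -> cmeasurable (fun x => (f x)^*).
Proof.
move=> [f1 f2]; split.
  by rewrite (_ : _ \o _ = @complex.Re R \o f) //; apply/funext => x /=; rewrite ReJ.
rewrite (_ : _ \o _ = \- (@complex.Im R \o f)); last by apply/funext => x /=; rewrite ImJ.
exact: measurableT_comp.
Qed.

Lemma bounded_cintegrable f : cmeasurable f -> (forall x, D x -> `|f x| <= 1) ->
  cintegrable f.
Proof.
move=> [f1 f2] fb.
have muD : (mu D < +oo)%E by apply: le_lt_trans (probability_le1 mu mD) _; rewrite ltry.
split; apply: measurable_bounded_integrable => //; try exact: measurable_funTS.
  exists 1; split => // M M1 x Dx /=; apply: le_trans (ltW M1).
  by rewrite -lecR; apply: le_trans (normc_ge_Re _) (fb _ Dx).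
exists 1; split => // M M1 x Dx /=; apply: le_trans (ltW M1).
rewrite -lecR; have -> : complex.Im (f x) = - complex.Re ('i * f x).
  by rewrite ReM /= mul0r mul1r sub0r opprK.
rewrite normrN; apply: le_trans (normc_ge_Re _) _.
by rewrite normrM normCi mul1r fb.
Qed.

Lemma eq_cintegral f g : (forall x, D x -> f x = g x) -> cintegral f = cintegral g.
Proof.
by move=> fg; congr (_ +i* _)%C; apply: eq_Rintegral => x /set_mem /fg ->.
Qed.

Lemma cintegral_cst (c : C) : mu D = 1%E -> cintegral (fun=> c) = c.
Proof.
move=> muD; have fD : fine (mu D) = 1 by rewrite muD.
rewrite /cintegral !Rintegral_cst //= !fD !mulr1.
by case: c.
Qed.

Lemma cintegralD f g : cintegrable f -> cintegrable g ->
  cintegrable (fun x => f x + g x) /\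
  cintegral (fun x => f x + g x) = cintegral f + cintegral g.
Proof.
move=> [f1 f2] [g1 g2].
have eR : (@complex.Re R \o (fun x => f x + g x)) = (@complex.Re R \o f) \+ (@complex.Re R \o g).
  by apply/funext => x /=; rewrite raddfD.
have eI : (@complex.Im R \o (fun x => f x + g x)) = (@complex.Im R \o f) \+ (@complex.Im R \o g).
  by apply/funext => x /=; rewrite raddfD.
split.
  split; rewrite ?eR ?eI.
    by have := integrableD mD f1 g1.
  by have := integrableD mD f2 g2.
rewrite /cintegral; apply/eqP; rewrite eq_complex /=; apply/andP; split; apply/eqP.
  by rewrite -RintegralD //; apply: eq_Rintegral => x _; rewrite raddfD.
by rewrite -RintegralD //; apply: eq_Rintegral => x _; rewrite raddfD.
Qed.

(** The real and imaginary parts of [c * f x] both have this shape. *)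
Lemma integrable_lin (a b : R) (u v : T -> R) :
  mu.-integrable D (EFin \o u) -> mu.-integrable D (EFin \o v) ->
  mu.-integrable D (EFin \o (fun x => a * u x + b * v x)) /\
  \int[mu]_(x in D) (a * u x + b * v x) =
    a * (\int[mu]_(x in D) u x) + b * \int[mu]_(x in D) v x.
Proof.
move=> iu iv.
have iau : mu.-integrable D (EFin \o (fun x => a * u x)) by exact: (integrableZl mD a iu).
have ibv : mu.-integrable D (EFin \o (fun x => b * v x)) by exact: (integrableZl mD b iv).
split; first exact: (integrableD mD iau ibv).
by rewrite RintegralD // !RintegralZl.
Qed.

Lemma cintegralZ (c : C) f : cintegrable f ->
  cintegrable (fun x => c * f x) /\ cintegral (fun x => c * f x) = c * cintegral f.
Proof.
move=> [f1 f2].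
have [iR eR] := integrable_lin (complex.Re c) (- complex.Im c) f1 f2.
have [iI eI] := integrable_lin (complex.Im c) (complex.Re c) f1 f2.
have ER : (@complex.Re R \o (fun x => c * f x)) =
    (fun x => complex.Re c * complex.Re (f x) + - complex.Im c * complex.Im (f x)).
  by apply/funext => x /=; rewrite ReM mulNr.
have EI : (@complex.Im R \o (fun x => c * f x)) =
    (fun x => complex.Im c * complex.Re (f x) + complex.Re c * complex.Im (f x)).
  by apply/funext => x /=; rewrite ImM addrC.
split; first by split; rewrite ?ER ?EI.
rewrite /cintegral; apply/eqP; rewrite eq_complex ReM ImM /=; apply/andP; split; apply/eqP.
  by rewrite -mulNr -eR; apply: eq_Rintegral => x _; rewrite -[LHS]/((@complex.Re R \o (fun x => c * f x)) x) ER.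
by rewrite addrC -eI; apply: eq_Rintegral => x _; rewrite -[LHS]/((@complex.Im R \o (fun x => c * f x)) x) EI.
Qed.

Lemma cintegral_sum (I : Type) (r : seq I) (K : I -> C) (f : I -> T -> C) :
  (forall i, cintegrable (f i)) ->
  cintegrable (fun x => \sum_(i <- r) K i * f i x) /\
  cintegral (fun x => \sum_(i <- r) K i * f i x) = \sum_(i <- r) K i * cintegral (f i).
Proof.
move=> fi; elim: r => [|i r [IH1 IH2]].
  rewrite big_nil; under eq_fun do rewrite big_nil.
  split; first by split; exact: integrable0.
  by rewrite /cintegral /= !Rintegral_cst // !mul0r.
rewrite big_cons; under eq_fun do rewrite big_cons.
have [i1 e1] := cintegralZ (K i) (fi i).
by have [i2 ->] := cintegralD i1 IH1; rewrite e1 IH2.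
Qed.

End ComplexIntegral.

(** * Fourth moments of an invariant measure on isometries *)

(** The unit sphere for [n = 1], the unitary group for [n = d]. *)
Definition isometries (R : realType) (d n : nat) : set 'M[R[i]]_(d, n) :=
  [set X | X^t* *m X = 1%:M].

Section Isometries.
Variables (R : realType) (d n : nat).
Local Notation C := R[i].
Local Notation T := (borel_mx R d n).
Local Notation D := (@isometries R d n).

Lemma cmeasurable_entry a k : cmeasurable (fun X : T => (X : 'M[C]_(d, n)) a k).
Proof.
split; apply: continuous_borel_mx_measurable => X.
  exact: (continuous_comp (@coord_continuous C _ _ a k X) (@Re_continuous R _)).
exact: (continuous_comp (@coord_continuous C _ _ a k X) (@Im_continuous R _)).
Qed.

Lemma cmeasurable_mulmx_entry m (B : 'M[C]_(n, m)) a k :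
  cmeasurable (fun X : T => ((X : 'M[C]_(d, n)) *m B) a k).
Proof.
under eq_fun do rewrite mxE.
apply: cmeasurable_sum => j; apply: cmeasurableM; first exact: cmeasurable_entry.
exact: cmeasurable_cst.
Qed.

Lemma cmeasurable_monomial m (B : 'M[C]_(n, m)) k1 k2 k3 k4 a1 a2 a3 a4 :
  cmeasurable (fun X : T => mx_monomial22 k1 k2 k3 k4 a1 a2 a3 a4 ((X : 'M[C]_(d, n)) *m B)).
Proof.
rewrite /mx_monomial22; have mE := cmeasurable_mulmx_entry B.
by do 3 (apply: cmeasurableM; last by [|apply: cmeasurableJ]).
Qed.

Lemma cmeasurable_mulmx_comp (G : 'M[C]_d) (f : T -> C) : cmeasurable f ->
  cmeasurable (fun X : T => f (G *m (X : 'M[C]_(d, n)))).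
Proof.
move=> [f1 f2]; split.
  exact: (measurableT_comp f1 (mulmx_measurable G)).
exact: (measurableT_comp f2 (mulmx_measurable G)).
Qed.

(** The set is the zero locus of [h], the sum of the squared moduli of the entries of
    [X^t* *m X - 1]. *)
Lemma measurable_isometries : measurable (D : set T).
Proof.
pose E (q : 'I_n * 'I_n) (X : 'M[C]_(d, n)) := (X^t* *m X) q.1 q.2 - (q.1 == q.2)%:R.
pose h (X : T) := \sum_(q : 'I_n * 'I_n) E q X * (E q X)^*.
have mE q : cmeasurable (E q : T -> C).
  rewrite /E; under eq_fun do rewrite mxE.
  apply: cmeasurableD; last exact: cmeasurable_cst.
  apply: cmeasurable_sum => a; apply: cmeasurableM; last exact: cmeasurable_entry.
  under eq_fun do rewrite !mxE.
  by apply: cmeasurableJ; exact: cmeasurable_entry.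
have mh : cmeasurable h.
  by apply: cmeasurable_sum => q; apply: cmeasurableM => //; exact: cmeasurableJ.
have -> : D = (@complex.Re R \o h) @^-1` [set 0].
  apply/seteqP; split=> [X /= XX|X /= hX].
    by rewrite /h big1 // => q _; rewrite /E XX mxE subrr mul0r.
  (* A nonnegative complex number is real, so a zero real part suffices. *)
  have h0 : h X = 0.
    have hge : 0 <= h X by apply: sumr_ge0 => q _; exact: mul_conjC_ge0.
    by rewrite [h X]complexE hX (ger0_Im hge) mulr0 addr0.
  apply/matrixP => i j.
  have /eqP := h0; rewrite psumr_eq0 => [/allP/(_ (i, j))|q _]; last exact: mul_conjC_ge0.
  rewrite mem_index_enum => /(_ isT) /=.
  by rewrite mul_conjC_eq0 /E subr_eq0 => /eqP ->; rewrite mxE.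
have [mRe _] := mh.
by rewrite -[X in measurable X]setTI; apply: mRe.
Qed.

End Isometries.

(** * Evaluation of the moments by invariance *)

Section Moments.
Variables (R : realType) (d n : nat) (mu : probability (borel_mx R d n) R).
Local Notation C := R[i].
Local Notation T := (borel_mx R d n).
Local Notation D := (@isometries R d n).
Hypothesis muD : mu D = 1%E.
Hypothesis mu_inv : forall G : 'M[C]_d, G \is unitarymx ->
  forall A : set T, measurable A ->
    mu ((fun X : 'M[C]_(d, n) => G *m X) @^-1` A) = mu A.

Lemma isometries_preimage (G : 'M[C]_d) : G \is unitarymx ->
  (fun X : 'M[C]_(d, n) => G *m X) @^-1` D = D.
Proof.
move=> hG; have GG : G^t* *m G = 1%:M by apply/mulmx1C/unitarymxP.
apply/seteqP; split=> X /=;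
  by rewrite /isometries /= trmx_mul map_mxM mulmxA -(mulmxA _ _ G) GG mulmx1.
Qed.

(** Change of variables: the image of [mu] under X |-> G X is [mu], and [D] is its own preimage. *)
Lemma Rintegral_invariant (G : 'M[C]_d) (u : T -> R) : G \is unitarymx ->
  measurable_fun setT u ->
  mu.-integrable D (EFin \o (fun X => u (G *m (X : 'M[C]_(d, n))))) ->
  \int[mu]_(X in D) u (G *m (X : 'M[C]_(d, n))) = \int[mu]_(X in D) u X.
Proof.
move=> hG mu0 iu; rewrite /Rintegral; congr fine.
have mD := @measurable_isometries R d n.
pose phi : T -> T := fun X => G *m (X : 'M[C]_(d, n)).
have mphi : measurable_fun setT phi by exact: mulmx_measurable.
have mu_ : measurable_fun setT (EFin \o u) by exact/measurable_EFinP.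
have iu' : mu.-integrable (phi @^-1` D) ((EFin \o u) \o phi).
  by rewrite [phi @^-1` D](isometries_preimage hG).
have := integral_pushforward mphi mu_ iu' mD.
rewrite [phi @^-1` D](isometries_preimage hG) => /esym /= ->.
apply: eq_measure_integral => A mA _.
exact: mu_inv.
Qed.

Lemma cintegral_invariant (G : 'M[C]_d) (f : T -> C) : G \is unitarymx ->
  cmeasurable f -> cintegrable mu D (fun X => f (G *m (X : 'M[C]_(d, n)))) ->
  cintegral mu D (fun X => f (G *m (X : 'M[C]_(d, n)))) = cintegral mu D f.
Proof.
move=> hG [f1 f2] [i1 i2]; congr (_ +i* _)%C.
  exact: (@Rintegral_invariant G (@complex.Re R \o f)).
exact: (@Rintegral_invariant G (@complex.Im R \o f)).
Qed.

Variables (m : nat) (B : 'M[C]_(n, m)).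
Hypothesis BB : B^t* *m B = 1%:M.

Lemma isometry_mulmx (X : 'M[C]_(d, n)) : D X -> (X *m B)^t* *m (X *m B) = 1%:M.
Proof.
by move=> XX; rewrite trmx_mul map_mxM mulmxA -(mulmxA _ _ X) XX mulmx1.
Qed.

Lemma cintegrable_monomial k1 k2 k3 k4 a1 a2 a3 a4 :
  cintegrable mu D (fun X => mx_monomial22 k1 k2 k3 k4 a1 a2 a3 a4 ((X : 'M[C]_(d, n)) *m B)).
Proof.
apply: bounded_cintegrable; first exact: measurable_isometries.
  exact: cmeasurable_monomial.
by move=> X DX; apply: isometry_monomial_le1; exact: isometry_mulmx.
Qed.

(** The fixed right factor [B] commutes with the left action. It is 1 for the sphere and [V^T] for
    the integral over [W] at fixed [V]. *)
Definition moment k1 k2 k3 k4 a1 a2 a3 a4 : C :=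
  cintegral mu D (fun X => mx_monomial22 k1 k2 k3 k4 a1 a2 a3 a4 ((X : 'M[C]_(d, n)) *m B)).

(** All indices may vary with [i], so that contractions over rows and the quartic form of the purity
    are both covered. *)
Lemma sum_cintegral_monomials (I : Type) (r : seq I) (K : I -> C) k1 k2 k3 k4
    (a1 a2 a3 a4 : I -> 'I_d) :
  cintegral mu D (fun X => \sum_(i <- r) K i *
     mx_monomial22 (k1 i) (k2 i) (k3 i) (k4 i) (a1 i) (a2 i) (a3 i) (a4 i)
       ((X : 'M[C]_(d, n)) *m B)) =
  \sum_(i <- r) K i * moment (k1 i) (k2 i) (k3 i) (k4 i) (a1 i) (a2 i) (a3 i) (a4 i).
Proof.
have mD := @measurable_isometries R d n.
have [|_ ->] := @cintegral_sum R _ T mu D mD I r K (fun i X =>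
  mx_monomial22 (k1 i) (k2 i) (k3 i) (k4 i) (a1 i) (a2 i) (a3 i) (a4 i)
       ((X : 'M[C]_(d, n)) *m B)) => //.
by move=> i; exact: cintegrable_monomial.
Qed.

(** Replacing X by G X leaves the integral unchanged, while the monomial expands linearly in the
    monomials of X B. *)
Lemma moment_invariant k1 k2 k3 k4 : invariant_tensor (moment k1 k2 k3 k4).
Proof.
move=> G hG a1 a2 a3 a4; rewrite /moment sum4E.
rewrite -[LHS](@cintegral_invariant G) //.
- rewrite -(sum_cintegral_monomials _ _ (fun=> k1) (fun=> k2) (fun=> k3) (fun=> k4)).
  by apply: eq_cintegral => X _; rewrite -mulmxA mx_monomial22_mulmx sum4E.
- exact: cmeasurable_monomial.
apply: bounded_cintegrable; first exact: measurable_isometries.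
- exact: (@cmeasurable_mulmx_comp _ _ _ G _ (cmeasurable_monomial B _ _ _ _ _ _ _ _)).
- move=> X DX; apply: isometry_monomial_le1; apply: isometry_mulmx.
  by move: DX; rewrite -{1}(isometries_preimage hG).
Qed.

(** Both contractions are integrals of functions constant on [D], because X B is an isometry, and
    [mu D = 1]. *)
Lemma momentE k1 k2 k3 k4 a1 a2 a3 a4 : (2 <= d)%N ->
  moment k1 k2 k3 k4 a1 a2 a3 a4 =
    (d%:R * (d%:R ^+ 2 - 1))^-1 *
    (pairing13 C a1 a2 a3 a4 * (d%:R * pairing13 C k1 k2 k3 k4 - pairing14 C k1 k2 k3 k4) +
     pairing14 C a1 a2 a3 a4 * (d%:R * pairing14 C k1 k2 k3 k4 - pairing13 C k1 k2 k3 k4)).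
Proof.
move=> d2; apply: invariant_tensor_contractions => //; first exact: moment_invariant.
  rewrite pair_bigA /=.
  under eq_bigr do rewrite -[moment _ _ _ _ _ _ _ _]mul1r.
  rewrite -(sum_cintegral_monomials _ (fun=> 1) (fun=> k1) (fun=> k2) (fun=> k3) (fun=> k4)
    (fun p => p.1) (fun p => p.2) (fun p => p.1) (fun p => p.2)).
  rewrite -[RHS](cintegral_cst (@measurable_isometries R d n) _ muD).
  apply: eq_cintegral => X DX; under eq_bigr do rewrite mul1r.
  rewrite -(pair_bigA _ (fun a b => mx_monomial22 k1 k2 k3 k4 a b a b (X *m B))).
  by apply: contract13; exact: isometry_mulmx.
rewrite pair_bigA /=.
under eq_bigr do rewrite -[moment _ _ _ _ _ _ _ _]mul1r.
rewrite -(sum_cintegral_monomials _ (fun=> 1) (fun=> k1) (fun=> k2) (fun=> k3) (fun=> k4)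
    (fun p => p.1) (fun p => p.2) (fun p => p.2) (fun p => p.1)).
rewrite -[RHS](cintegral_cst (@measurable_isometries R d n) _ muD).
apply: eq_cintegral => X DX; under eq_bigr do rewrite mul1r.
rewrite -(pair_bigA _ (fun a b => mx_monomial22 k1 k2 k3 k4 a b b a (X *m B))).
by apply: contract14; exact: isometry_mulmx.
Qed.

End Moments.

(** The linear entropy depends on the purity in this affine way. *)
Lemma Rintegral_affine_Re (R : realType) disp (T : measurableType disp)
    (mu : probability T R) (D : set T) (mD : measurable D) (c : R) (f : T -> R[i]) :
  mu D = 1%E -> cintegrable mu D f ->
  \int[mu]_(x in D) (c * (1 - complex.Re (f x))) = c * (1 - complex.Re (cintegral mu D f)).
Proof.
move=> muD [f1 _]; have fD : fine (mu D) = 1 by rewrite muD.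
have i1 : mu.-integrable D (EFin \o (fun=> 1 : R)).
  apply: measurable_bounded_integrable => //.
    by apply: le_lt_trans (probability_le1 mu mD) _; rewrite ltry.
  by exists 1; split => // M M1 x _ /=; rewrite normr1 ltW.
have [_ e] := integrable_lin mD (- c) c f1 i1.
transitivity (\int[mu]_(x in D) (- c * complex.Re (f x) + c * 1)).
  by apply: eq_Rintegral => x _; ring.
apply: (etrans e); rewrite Rintegral_cst // fD /=; ring.
Qed.

Lemma ReZ (R : realType) (a : R) (z : R[i]) :
  complex.Re (a%:C%C * z) = a * complex.Re z.
Proof. by case: z => x y /=; rewrite mul0r subr0. Qed.

(** * Entangling and disentangling powers *)

Section NatNeq0.
Variables (F : numDomainType) (d : nat) (d2 : (2 <= d)%N).

Lemma natd_neq0 : d%:R != 0 :> F.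
Proof. by rewrite pnatr_eq0 -lt0n (leq_trans _ d2). Qed.

Lemma natd1_neq0 : d%:R + 1 != 0 :> F.
Proof. by rewrite natr1 pnatr_eq0. Qed.

Lemma natdsq1_neq0 : d%:R ^+ 2 - 1 != 0 :> F.
Proof.
rewrite subr_eq0 sqrp_eq1 ?ler0n // pnatr_eq1.
by apply: contraTneq d2 => ->.
Qed.
End NatNeq0.

Section Averages.
Variables (R : realType) (d : nat) (d2 : (2 <= d)%N).
Local Notation C := R[i].
Local Notation u1 q := (mxtens_unindex q).1.
Local Notation u2 q := (mxtens_unindex q).2.

(** For square matrices a right inverse is a left inverse. *)
Lemma unitary_groupE : @unitary_group R d = @isometries R d d.
Proof.
by apply/seteqP; split=> V /= VV; [apply/mulmx1C/unitarymxP | apply/unitarymxP/mulmx1C].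
Qed.

Lemma monomial22_tens (x y : 'cV[C]_d) (q1 q2 q3 q4 : 'I_(d * d)) :
  monomial22 ((x *t y : 'cV[C]_(d * d))^~ 0) q1 q2 q3 q4 =
  mx_monomial22 0 0 0 0 (u1 q1) (u1 q2) (u1 q3) (u1 q4) x *
  mx_monomial22 0 0 0 0 (u2 q1) (u2 q2) (u2 q3) (u2 q4) y.
Proof.
rewrite /monomial22 /mx_monomial22 !mxE !ord1 !rmorphM /=; ring.
Qed.

(* [W *m V^T], rather than its transpose, so that the integration over [W] meets
   a left-invariant measure. *)
Lemma max_entangledE (V W : 'M[C]_d) (p : 'I_(d * d)) :
  ((V *t W) *m max_entangled R d) p 0 =
  (sqrtC d%:R)^-1 * (W *m V^T) (u2 p) (u1 p).
Proof.
rewrite /max_entangled -scalemxAr mxE; congr (_ * _).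
rewrite mulmx_sumr summxE !mxE; apply: eq_bigr => i _.
(* The column index is read in ['I_(1 * 1)], as the tensor product of two columns requires. *)
transitivity (((V *t W) *m ((delta_mx i 0 : 'cV[C]_d) *t (delta_mx i 0 : 'cV[C]_d)))
  p (0 : 'I_(1 * 1))) => //.
rewrite tensmx_mul [LHS]mxE [RHS]mulrC !mxE; congr (_ * _).
  rewrite (bigD1 i) //= mxE !eqxx mulr1 big1 ?addr0 // => j /negbTE nj.
  by rewrite mxE nj mulr0.
rewrite (bigD1 i) //= !mxE !eqxx mulr1 big1 ?addr0 // => j /negbTE nj.
by rewrite mxE nj mulr0.
Qed.

(** Four factors 1/sqrt d give 1/d^2. First tensor indices become columns, second ones rows. *)
Lemma monomial22_max_entangled (V W : 'M[C]_d) (q1 q2 q3 q4 : 'I_(d * d)) :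
  monomial22 (((V *t W) *m max_entangled R d)^~ 0) q1 q2 q3 q4 =
  (d%:R ^+ 2)^-1 * mx_monomial22 (u1 q1) (u1 q2) (u1 q3) (u1 q4)
     (u2 q1) (u2 q2) (u2 q3) (u2 q4) (W *m V^T).
Proof.
rewrite /monomial22 /mx_monomial22 !max_entangledE !(rmorphM _ (sqrtC d%:R)^-1) /=.
have sJ : ((sqrtC d%:R : C)^-1)^* = (sqrtC d%:R)^-1.
  by apply: geC0_conj; rewrite invr_ge0 sqrtC_ge0 ler0n.
rewrite sJ -[in RHS](sqrtCK d%:R) -exprM.
have : sqrtC d%:R != 0 :> C by rewrite sqrtC_eq0 pnatr_eq0 -lt0n (leq_trans _ d2).
move: (sqrtC _) => s s0; field.
exact: s0.
Qed.

Variables (U : 'M[C]_(d * d)) (hU : U \is unitarymx).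

(** Each vector averages to (D13 + D14) / (d (d + 1)), so the mean purity is the sum of all four
    contractions over (d (d + 1))^2. *)
Lemma entangling_powerE (mu : probability (borel_mx R d 1) R) :
  is_uniform_sphere mu ->
  entangling_power mu U = d%:R / (d%:R - 1) *
    (1 - (2 * d%:R ^+ 3 + complex.Re (contract_coef U (@pairing13 C _) (@pairing14 C _) +
       contract_coef U (@pairing14 C _) (@pairing13 C _))) / (d%:R * (d%:R + 1)) ^+ 2).
Proof.
move=> [muS mu_inv].
have mD := @measurable_isometries R d 1.
have I1 : (1%:M : 'M[C]_1)^t* *m 1%:M = 1%:M by rewrite trmx1 map_mx1 mulmx1.
pose M (a1 a2 a3 a4 : 'I_d) := moment mu (1%:M : 'M[C]_1) 0 0 0 0 a1 a2 a3 a4.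
pose c : R := d%:R / (d%:R - 1).
pose K (q : 'I_(d * d) * 'I_(d * d) * 'I_(d * d) * 'I_(d * d)) :=
   purity_coef U q.1.1.1 q.1.1.2 q.1.2 q.2.
(* With [x] fixed, its monomial joins the coefficients and only the monomial in [y] is averaged. *)
have inner (x : 'cV[C]_d) :
   \int[mu]_(y in @unit_sphere R d) lin_entropy (U *m (x *t y)) =
   c * (1 - complex.Re (\sum_q (K q * M (u2 q.1.1.1) (u2 q.1.1.2) (u2 q.1.2) (u2 q.2)) *
       mx_monomial22 0 0 0 0 (u1 q.1.1.1) (u1 q.1.1.2) (u1 q.1.2) (u1 q.2) (x *m 1%:M))).
  pose f y := \sum_q (K q * mx_monomial22 0 0 0 0 (u1 q.1.1.1) (u1 q.1.1.2) (u1 q.1.2) (u1 q.2) x) *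
      mx_monomial22 0 0 0 0 (u2 q.1.1.1) (u2 q.1.1.2) (u2 q.1.2) (u2 q.2) ((y : 'cV[C]_d) *m 1%:M).
  transitivity (\int[mu]_(y in @isometries R d 1) (c * (1 - complex.Re (f y)))).
    apply: eq_Rintegral => y _; rewrite -[LHS]/(c * (1 - complex.Re (purity _))).
    rewrite purity_mulmx sum4E /f mulmx1; congr (c * (1 - complex.Re _)).
    by apply: eq_bigr => q _; rewrite monomial22_tens mulrA.
  rewrite Rintegral_affine_Re //; last first.
    by have [] := cintegral_sum mD (index_enum _)
      (fun q => K q * mx_monomial22 0 0 0 0 (u1 q.1.1.1) (u1 q.1.1.2) (u1 q.1.2) (u1 q.2) x)
      (fun q => cintegrable_monomial mu I1 0 0 0 0 (u2 q.1.1.1) (u2 q.1.1.2) (u2 q.1.2) (u2 q.2)).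
  rewrite sum_cintegral_monomials // mulmx1.
  congr (c * (1 - complex.Re _)); apply: eq_bigr => q _; rewrite /M; ring.
transitivity (\int[mu]_(x in @isometries R d 1)
   (c * (1 - complex.Re (\sum_q (K q * M (u2 q.1.1.1) (u2 q.1.1.2) (u2 q.1.2) (u2 q.2)) *
       mx_monomial22 0 0 0 0 (u1 q.1.1.1) (u1 q.1.1.2) (u1 q.1.2) (u1 q.2) ((x : 'cV[C]_d) *m 1%:M))))).
  by apply: eq_Rintegral => x _; rewrite inner.
rewrite Rintegral_affine_Re //; last first.
  by have [] := cintegral_sum mD (index_enum _)
      (fun q => K q * M (u2 q.1.1.1) (u2 q.1.1.2) (u2 q.1.2) (u2 q.2))
      (fun q => cintegrable_monomial mu I1 0 0 0 0 (u1 q.1.1.1) (u1 q.1.1.2) (u1 q.1.2) (u1 q.2)).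
rewrite sum_cintegral_monomials //; congr (c * (1 - _)).
(* For a single column both pairings of column indices are 1, and (d - 1) / (d (d^2 - 1)) = 1 / (d
   (d + 1)). *)
pose g : R := (d%:R * (d%:R + 1))^-1.
have ME a1 a2 a3 a4 : M a1 a2 a3 a4 =
    g%:C%C * (pairing13 C a1 a2 a3 a4 + pairing14 C a1 a2 a3 a4).
  have p13 : pairing13 C 0 0 0 (0 : 'I_1) = 1 by rewrite /pairing13 !eqxx mulr1.
  have p14 : pairing14 C 0 0 0 (0 : 'I_1) = 1 by rewrite /pairing14 !eqxx mulr1.
  rewrite /M momentE // p13 p14.
  rewrite /g fmorphV rmorphM rmorphD rmorph1 /= !rmorph_nat.
  by field; apply/and3P; split; [exact: natd1_neq0 | exact: natd_neq0 | exact: natdsq1_neq0].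
transitivity (complex.Re ((g ^+ 2)%:C%C * ((2 * d%:R ^+ 3)%:C%C +
    (contract_coef U (@pairing13 C _) (@pairing14 C _) +
       contract_coef U (@pairing14 C _) (@pairing13 C _))))); last first.
  by rewrite ReZ raddfD /= mulrC /g exprVn.
congr complex.Re; transitivity (
  (g ^+ 2)%:C%C * contract_coef U (@pairing13 C _) (@pairing13 C _) +
  (g ^+ 2)%:C%C * contract_coef U (@pairing13 C _) (@pairing14 C _) +
  (g ^+ 2)%:C%C * contract_coef U (@pairing14 C _) (@pairing13 C _) +
  (g ^+ 2)%:C%C * contract_coef U (@pairing14 C _) (@pairing14 C _)); last first.
  rewrite contract_coef1313 // contract_coef1414 //.
  have -> : (2 * d%:R ^+ 3)%:C%C = 2 * d%:R ^+ 3 :> C.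
    by rewrite rmorphM rmorphXn /= !rmorph_nat.
  ring.
rewrite -contract_coef_bilinear sum4E; apply: eq_bigr => q _ /=.
rewrite -/(M _ _ _ _) !ME rmorphXn /K /=; ring.
Qed.

(** The column pairings of the moment formula act on the first tensor factor, the row pairings on
    the second: equal pairings get weight d, mixed ones weight -1. *)
Lemma disentangling_powerE (nu : probability (borel_mx R d d) R) :
  is_haar nu ->
  disentangling_power nu U = 1 - d%:R / (d%:R - 1) *
    (1 - (2 * d%:R ^+ 4 - complex.Re (contract_coef U (@pairing13 C _) (@pairing14 C _) +
       contract_coef U (@pairing14 C _) (@pairing13 C _))) /
      (d%:R ^+ 3 * (d%:R ^+ 2 - 1))).
Proof.
rewrite /is_haar /disentangling_power unitary_groupE => -[nuS nu_inv].
have mD := @measurable_isometries R d d.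
pose c : R := d%:R / (d%:R - 1).
pose K (q : 'I_(d * d) * 'I_(d * d) * 'I_(d * d) * 'I_(d * d)) :=
   purity_coef U q.1.1.1 q.1.1.2 q.1.2 q.2.
congr (1 - _).
(* [r] is the average over [W], the same for every unitary [V], so the outer integral is that of a
   constant. *)
set r : R := c * _.
transitivity (\int[nu]_(V in @isometries R d d) r); last first.
  have fD : fine (nu (@isometries R d d)) = 1 by rewrite nuS.
  by rewrite Rintegral_cst // fD mulr1.
apply: eq_Rintegral => V /set_mem; rewrite -unitary_groupE /= => VV.
have VB : (V^T)^t* *m V^T = 1%:M.
  by apply/mulmx1C/unitarymxP; rewrite trmx_unitary.
rewrite unitary_groupE.
pose f W := \sum_q (K q * (d%:R ^+ 2)^-1) *
      mx_monomial22 (u1 q.1.1.1) (u1 q.1.1.2) (u1 q.1.2) (u1 q.2)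
       (u2 q.1.1.1) (u2 q.1.1.2) (u2 q.1.2) (u2 q.2) ((W : 'M[C]_d) *m V^T).
transitivity (\int[nu]_(W in @isometries R d d) (c * (1 - complex.Re (f W)))).
  apply: eq_Rintegral => W _; rewrite -[LHS]/(c * (1 - complex.Re (purity _))).
  rewrite purity_mulmx sum4E /f; congr (c * (1 - complex.Re _)).
  by apply: eq_bigr => q _; rewrite monomial22_max_entangled mulrA.
rewrite Rintegral_affine_Re //; last first.
  by have [] := cintegral_sum mD (index_enum _) (fun q => K q * (d%:R ^+ 2)^-1)
      (fun q => cintegrable_monomial nu VB (u1 q.1.1.1) (u1 q.1.1.2) (u1 q.1.2) (u1 q.2)
        (u2 q.1.1.1) (u2 q.1.1.2) (u2 q.1.2) (u2 q.2)).
rewrite sum_cintegral_monomials //; congr (c * (1 - _)).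
(* The normalization 1/d^2 of the state times the factor 1 / (d (d^2 - 1)) of the moments. *)
pose g : R := (d%:R ^+ 3 * (d%:R ^+ 2 - 1))^-1.
transitivity (complex.Re (g%:C%C * ((2 * d%:R ^+ 4)%:C%C -
    (contract_coef U (@pairing13 C _) (@pairing14 C _) +
       contract_coef U (@pairing14 C _) (@pairing13 C _))))); last first.
  by rewrite ReZ raddfB /= mulrC.
congr complex.Re; transitivity (
  (g * d%:R)%:C%C * contract_coef U (@pairing13 C _) (@pairing13 C _) +
  - g%:C%C * contract_coef U (@pairing13 C _) (@pairing14 C _) +
  - g%:C%C * contract_coef U (@pairing14 C _) (@pairing13 C _) +
  (g * d%:R)%:C%C * contract_coef U (@pairing14 C _) (@pairing14 C _)); last first.
  rewrite contract_coef1313 // contract_coef1414 //.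
  have -> : (2 * d%:R ^+ 4)%:C%C = 2 * d%:R ^+ 4 :> C.
    by rewrite rmorphM rmorphXn /= !rmorph_nat.
  rewrite rmorphM /= rmorph_nat; ring.
rewrite -contract_coef_bilinear sum4E; apply: eq_bigr => q _ /=.
rewrite momentE // /g rmorphM fmorphV rmorphM rmorphB !rmorphXn rmorph1 /= !rmorph_nat /K.
field; apply/andP; split; [exact: natdsq1_neq0|exact: natd_neq0].
Qed.

End Averages.

Theorem mainTheorem2 (R : realType) (d : nat) (hd : (2 <= d)%N)
    (mu : probability (borel_mx R d 1) R) (hmu : is_uniform_sphere mu)
    (nu : probability (borel_mx R d d) R) (hnu : is_haar nu)
    (U : 'M[R[i]]_(d * d)) (hU : U \is unitarymx) :
  disentangling_power nu U
  = (d%:R + 1) / (d%:R * (d%:R - 1)) * entangling_power mu U.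
Proof.
rewrite disentangling_powerE // entangling_powerE //.
(* Both sides are affine in the real part of the sum of the mixed contractions, with slope -1 / (d^2
   (d - 1)^2 (d + 1)). *)
field; rewrite natd_neq0 // natd1_neq0 // natdsq1_neq0 // subr_eq0 pnatr_eq1.
by rewrite gtn_eqF.
Qed.
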